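(* Let $A$ be a Banach algebra, $B$ a Banach $A$-bimodule and $n\ge1$. If $H^1(A,B^{(n+2)})=0$, then $H^1(A,B^{(n)})=0$.
   Context: $B^{(n)}$ denotes the $n$-th dual of $B$. It is a Banach $A$-bimodule via $\langle b^{(n)}a,b^{(n-1)}\rangle=\langle b^{(n)},ab^{(n-1)}\rangle$ and $\langle ab^{(n)},b^{(n-1)}\rangle=\langle b^{(n)},b^{(n-1)}a\rangle$. For a Banach $A$-bimodule $E$, a derivation $D:A\to E$ is a bounded linear map with $D(xy)=xD(y)+D(x)y$; it is inner if $D(a)=ae-ea$ for some $e\in E$. $H^1(A,E)$ is the quotient of the space $Z^1(A,E)$ of all derivations by the subspace $N^1(A,E)$ of inner ones. *)

(* Defs.v *)
From HB Require Import structures.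
From mathcomp Require Import all_boot all_order all_algebra.
From mathcomp Require Import ring complex.
From mathcomp Require Import all_classical all_reals topology normedtype.

Set Implicit Arguments.
Unset Strict Implicit.
Unset Printing Implicit Defensive.

Import Order.TTheory GRing.Theory Num.Theory.
Import numFieldNormedType.Exports.

Local Open Scope classical_set_scope.
Local Open Scope ring_scope.

(* The theory is developed simultaneously over the real and the complex
   numbers, the two usual choices of scalars for Banach algebras. *)
Variant scalar_kind := RealScalars | ComplexScalars.

Definition scalars (R : realType) (s : scalar_kind) : numFieldType :=
  match s with
  | RealScalars => R
  | ComplexScalars => R[i]
  end.

Lemma scalars_supremums (R : realType) s (S : set (scalars R s)) :
  S !=set0 -> (forall x, S x -> 0 <= x) -> (exists M, ubound S M) ->
  supremums S !=set0.
Proof.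
case: s S => [/=|] S [x0 Sx0] S0 [M SM].
  exists (sup (S : set R)); split.
    by apply: sup_upper_bound; split; [exists x0|exists M].
  by move=> y Sy; apply: ge_sup => //; exists x0.
have realS z : S z -> (z : R[i]) = (complex.Re z)%:C%C.
  by move=> /S0; rewrite -[0]/(0 : R[i]) lecE /= => /andP[/eqP]; case: z => a b /= ->.
have ubRe (y : R[i]) : ubound S y -> forall z, S z -> complex.Re z <= complex.Re y.
  by move=> Sy z /Sy; rewrite -[_ <= _]/((z : R[i]) <= y) lecE => /andP[].
pose T : set R := [set complex.Re (z : R[i]) | z in S].
have hT : has_sup T.
  split; first by exists (complex.Re (x0 : R[i])), x0.
  by exists (complex.Re (M : R[i])) => _ [z Sz <-]; exact: ubRe.
exists ((sup T)%:C%C : R[i]); split.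
  move=> z Sz; rewrite (realS _ Sz) -[_ <= _]/((_ : R[i]) <= _) lecE /= eqxx /=.
  by apply: sup_upper_bound => //; exists z.
move=> y Sy; rewrite -[_ <= _]/(((sup T)%:C%C : R[i]) <= y) lecE /=.
apply/andP; split.
  have := Sy _ Sx0; rewrite (realS _ Sx0) -[_ <= _]/((_ : R[i]) <= y) lecE /=.
  by case/andP.
by apply: ge_sup; [case: hT|move=> _ [z Sz <-]; exact: ubRe].
Qed.

Lemma complex_cauchy_cvg (R : realType) (F : set_system (R[i] : numFieldType)) :
  ProperFilter F -> cauchy F -> cvg F.
Proof.
move=> FF /cauchy_ballP Fc.
have Kc (p : R[i] -> R) : (forall x y, p (x - y) = p x - p y) ->
    (forall x, `|p x|%:C%C <= `|x|) -> cauchy (p @ F).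
  move=> pB ple; apply/cauchy_ballP => e e0.
  have e0' : 0 < e%:C%C :> R[i] by rewrite ltcR.
  have := Fc _ e0'; rewrite !near_simpl => -[[U V] [FU FV] UV].
  exists (p @` U, p @` V) => /=.
    by split; [apply: filterS FU => x|apply: filterS FV => x]; exists x.
  move=> [_ _] /= [[x Ux <-] [y Vy <-]].
  have := UV (x, y) (conj Ux Vy).
  rewrite -!ball_normE /= -pB => xy.
  by rewrite -ltcR (le_lt_trans (ple _) xy).
have Rele x : `|complex.Re x|%:C%C <= `|x| :> R[i] by exact: normc_ge_Re.
have Imle x : `|complex.Im x|%:C%C <= `|x| :> R[i].
  case: x => a b; rewrite normc_def /= lecR -(sqrtr_sqr b) ler_wsqrtr//.
  by rewrite lerDr sqr_ge0.
have ReB (x y : R[i]) : complex.Re (x - y) = complex.Re x - complex.Re y.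
  by case: x y => [? ?] [? ?].
have ImB (x y : R[i]) : complex.Im (x - y) = complex.Im x - complex.Im y.
  by case: x y => [? ?] [? ?].
have /cvg_ex[a Fa] : cvg (@complex.Re R @ F) by apply: R_complete; exact: Kc.
have /cvg_ex[b Fb] : cvg (@complex.Im R @ F) by apply: R_complete; exact: Kc.
apply/cvg_ex; exists (Complex a b).
apply/cvgrPdist_lt => e e0.
have eE : e = (complex.Re e)%:C%C.
  by move: e0; rewrite ltcE /= => /andP[/eqP]; case: e => c d /= ->.
have re0 : 0 < complex.Re e / 2.
  by rewrite divr_gt0//; move: e0; rewrite ltcE /= => /andP[].
have Fa' : F [set z | `|a - complex.Re z| < complex.Re e / 2].
  by move: Fa => /cvgrPdist_lt /(_ _ re0).
have Fb' : F [set z | `|b - complex.Im z| < complex.Re e / 2].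
  by move: Fb => /cvgrPdist_lt /(_ _ re0).
apply: filterS2 Fa' Fb' => z /= za zb.
have -> : Complex a b - z = (a - complex.Re z)%:C%C + 'i%C * (b - complex.Im z)%:C%C.
  by case: z {za zb} => c d; simpc.
rewrite (le_lt_trans (ler_normD _ _))// normrM.
have -> : `|'i%C| = 1 :> R[i].
  by rewrite normc_def /= expr0n expr1n add0r sqrtr1.
rewrite mul1r !normc_def /= !expr0n /= !addr0 !sqrtr_sqr.
by rewrite [in ltRHS]eE -rmorphD ltcR (splitr (complex.Re e)) ltrD.
Qed.

Lemma scalars_cauchy_cvg (R : realType) s (F : set_system (scalars R s)) :
  ProperFilter F -> cauchy F -> cvg F.
Proof. by case: s F => F; [exact: R_complete|exact: complex_cauchy_cvg]. Qed.

Section bounded_linear.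
Context {K : numFieldType}.

Definition bounded_linear (V W : normedModType K) (f : V -> W) : Prop :=
  linear f /\ exists M, forall x, `|f x| <= M * `|x|.

Definition blin (V W : normedModType K) : {pred V -> W} :=
  mem [set f | bounded_linear f].
Arguments blin : clear implicits.

Lemma blinP (V W : normedModType K) (f : V -> W) :
  reflect (bounded_linear f) (f \in blin V W).
Proof. exact: asboolP. Qed.

Lemma bounded_linear_ge0 (V W : normedModType K) (f : V -> W) :
  bounded_linear f -> exists2 M, 0 <= M & forall x, `|f x| <= M * `|x|.
Proof.
move=> [_ [M fM]]; have [x0|V0] := pselect (exists x : V, x != 0).
  case: x0 => x x0; exists M => //.
  by rewrite -(pmulr_lge0 _ (_ : 0 < `|x|)) ?normr_gt0// (le_trans _ (fM x)).
exists 0 => // x; have -> : x = 0.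
  by apply: contrapT => /eqP x0; apply: V0; exists x.
by apply: le_trans (fM 0) _; rewrite normr0 !mulr0.
Qed.

Lemma blin_submod_closed (V W : normedModType K) :
  GRing.submod_closed (blin V W).
Proof.
split.
  apply/blinP; split; first by move=> a x y; rewrite /= scaler0 addr0.
  by exists 0 => x; rewrite normr0 mul0r.
move=> c f g /blinP fb /blinP gb; have [fl _] := fb; have [gl _] := gb.
have [M M0 fM] := bounded_linear_ge0 fb; have [N N0 gN] := bounded_linear_ge0 gb.
apply/blinP; split.
  move=> a x y; rewrite !fctE fl gl !scalerDr !scalerA [c * a]mulrC.
  by rewrite addrACA.
exists (`|c| * M + N) => x; rewrite !fctE mulrDl (le_trans (ler_normD _ _))//.
by rewrite lerD// normrZ -mulrA ler_wpM2l.
Qed.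

HB.instance Definition _ (V W : normedModType K) :=
  GRing.isSubmodClosed.Build K (V -> W) (blin V W) (blin_submod_closed V W).

End bounded_linear.
Arguments blin {K} V W.

Section dual_type.
Context {R : realType} {s : scalar_kind}.
Local Notation K := (scalars R s).

Record dual (V : normedModType K) := Dual {
  dual_val :> V -> K^o ;
  _ : dual_val \in blin V K^o }.

Section dual.
Variable V : normedModType K.

HB.instance Definition _ := [isSub for @dual_val V].
HB.instance Definition _ := [Choice of dual V by <:].
HB.instance Definition _ := [SubChoice_isSubLmodule of dual V by <:].

Lemma dualP (f : dual V) : bounded_linear f.
Proof. exact/blinP/(valP f). Qed.

(* The operator norm; the order on [scalars R s] is only partial when the
   scalars are complex, hence [supremum] rather than [sup]. *)
Definition dual_norm (f : dual V) : K :=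
  supremum 0 [set `|f x| | x in [set x | `|x| <= 1]].

Lemma dual_norm_supremums (f : dual V) :
  supremums [set `|f x| | x in [set x | `|x| <= 1]] (dual_norm f).
Proof.
have S0 : [set `|f x| | x in [set x | `|x| <= 1]] !=set0.
  by exists `|f 0|, 0 => //=; rewrite normr0.
rewrite /dual_norm /supremum ifF; last by apply/negbTE/set0P.
have Sge0 x : [set `|f x| | x in [set x | `|x| <= 1]] x -> 0 <= x.
  by move=> [y _ <-].
have Sub : exists M, ubound [set `|f x| | x in [set x | `|x| <= 1]] M.
  have [M M0 fM] := bounded_linear_ge0 (dualP f).
  by exists M => _ [x /= x1 <-]; rewrite (le_trans (fM x))// ler_piMr.
have [z Sz] := scalars_supremums S0 Sge0 Sub.
exact: (xgetPex 0 (ex_intro _ z Sz)).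
Qed.

Lemma dual_norm_ub (f : dual V) x : `|x| <= 1 -> `|f x| <= dual_norm f.
Proof. by move=> x1; apply: (dual_norm_supremums f).1; exists x. Qed.

Lemma dual_norm_le (f : dual V) M :
  (forall x, `|x| <= 1 -> `|f x| <= M) -> dual_norm f <= M.
Proof.
by move=> fM; apply: (dual_norm_supremums f).2 => _ [x /= x1 <-]; exact: fM.
Qed.

Lemma dual_norm_ge0 (f : dual V) : 0 <= dual_norm f.
Proof. by apply: le_trans (dual_norm_ub f (x := 0) _); rewrite ?normr0. Qed.

Lemma dual_linear (f : dual V) : linear f. Proof. by case: (dualP f). Qed.

Lemma dual0r (f : dual V) : f 0 = 0.
Proof.
by have := dual_linear f (-1) 0 0; rewrite scaler0 addr0 scaleN1r addNr.
Qed.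

Lemma dualZr (f : dual V) a x : f (a *: x) = a * f x.
Proof. by have := dual_linear f a x 0; rewrite dual0r !addr0. Qed.

Lemma dual_normP (f : dual V) x : `|f x| <= dual_norm f * `|x|.
Proof.
have [->|x0] := eqVneq x 0; first by rewrite dual0r !normr0 mulr0.
rewrite -ler_pdivrMr ?normr_gt0//.
have := @dual_norm_ub f (`|x|^-1 *: x).
rewrite dualZr normrZ normrM !normfV !normr_id mulVf ?normr_eq0// mulrC.
exact.
Qed.

Lemma dualDE (f g : dual V) x : (f + g) x = f x + g x. Proof. by []. Qed.
Lemma dualNE (f : dual V) x : (- f) x = - f x. Proof. by []. Qed.
Lemma dualZE a (f : dual V) x : (a *: f) x = a * f x. Proof. by []. Qed.
Lemma dual0E x : (0 : dual V) x = 0. Proof. by []. Qed.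

Lemma dual_eqP (f g : dual V) : (forall x, f x = g x) -> f = g.
Proof. by move=> fg; apply: val_inj; apply/funext. Qed.

Lemma dual_normD (f g : dual V) : dual_norm (f + g) <= dual_norm f + dual_norm g.
Proof.
apply: dual_norm_le => x x1; rewrite dualDE (le_trans (ler_normD _ _))//.
by rewrite lerD// dual_norm_ub.
Qed.

Lemma dual_normZ_le a (f : dual V) : dual_norm (a *: f) <= `|a| * dual_norm f.
Proof.
by apply: dual_norm_le => x x1; rewrite dualZE normrM ler_wpM2l// dual_norm_ub.
Qed.

Lemma dual_normZ a (f : dual V) : dual_norm (a *: f) = `|a| * dual_norm f.
Proof.
apply/le_anti; rewrite dual_normZ_le /=.
have [->|a0] := eqVneq a 0; first by rewrite normr0 mul0r dual_norm_ge0.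
rewrite -ler_pdivlMl ?normr_gt0//.
by rewrite -normfV -[in leLHS](scale1r f) -(mulVf a0) -scalerA dual_normZ_le.
Qed.

Lemma dual_norm0_eq0 (f : dual V) : dual_norm f = 0 -> f = 0.
Proof.
move=> f0; apply: dual_eqP => x; apply/eqP; rewrite -normr_le0.
by rewrite (le_trans (dual_normP f x))// f0 mul0r.
Qed.

HB.instance Definition _ := Lmodule_isNormed.Build K (dual V)
  dual_normD dual_normZ dual_norm0_eq0.

Lemma dual_normE (f : dual V) : `|f| = dual_norm f. Proof. by []. Qed.

Lemma dual_cauchy_cvg (F : set_system (dual V)) :
  ProperFilter F -> cauchy F -> cvg F.
Proof.
move=> FF /cauchy_ballP Fc.
have Fc' e : 0 < e -> exists2 U : set (dual V), F U &
    forall f g, U f -> U g -> `|f - g| < e.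
  move=> e0; have := Fc e e0; rewrite near_simpl => -[[U W] /= [FU FW] UW].
  exists (U `&` W); first exact: filterI.
  by move=> f g [Uf _] [_ Wg]; have := UW (f, g) (conj Uf Wg); rewrite -ball_normE.
have /choice[l lP] x : exists l : K, forall e, 0 < e -> F [set f | `|l - f x| < e].
  have : cvg ((fun f : dual V => (f x : K)) @ F).
    apply: scalars_cauchy_cvg; apply/cauchy_ballP => e e0.
    have x1 : 0 < `|x| + 1 by rewrite ltr_wpDl.
    have [U FU UP] := Fc' (e / (`|x| + 1)) (divr_gt0 e0 x1).
    rewrite near_simpl.
    exists (U, U) => //= -[f g] /= [Uf Ug].
    rewrite -ball_normE /= -[_ - _]/((f - g) x).
    rewrite (le_lt_trans (dual_normP _ _))//.
    have := UP f g Uf Ug; rewrite dual_normE ltr_pdivlMr//; apply: le_lt_trans.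
    by rewrite ler_wpM2l// ?dual_norm_ge0// lerDl.
  move=> /cvg_ex[l /= /cvgrPdist_lt lP]; exists l => e e0; exact: lP.
have lin : linear (l : V -> K^o).
  move=> a x y; apply/eqP; rewrite -subr_eq0 -normr_le0.
  apply/ler_addgt0Pl => e e0; rewrite addr0.
  have e3 : 0 < e / 3%:R / (`|a| + 1) by rewrite !divr_gt0// ltr_wpDl.
  have e3' : 0 < e / 3%:R by rewrite divr_gt0.
  have [f [[/= f1 f2] f3]] := filter_ex (filterI (filterI
    (lP (a *: x + y) _ e3') (lP x _ e3)) (lP y _ e3')).
  have -> : l (a *: x + y) - (a *: (l x : K^o) + l y) =
     (l (a *: x + y) - f (a *: x + y)) - (a * (l x - f x) + (l y - f y)).
    rewrite dual_linear -[a *: f x]/(a * f x) -[a *: (l x : K^o)]/(a * l x).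
    by rewrite mulrBr !opprD !opprK !addrA; ring.
  rewrite (le_trans (ler_normB _ _))//.
  have -> : e = e / 3%:R + (e / 3%:R + e / 3%:R) by field.
  rewrite lerD ?(ltW f1)// (le_trans (ler_normD _ _))// lerD ?(ltW f3)//.
  rewrite normrM; move: f2; rewrite ltr_pdivlMr ?ltr_wpDl// => /ltW.
  by apply: le_trans; rewrite mulrC ler_wpM2l// lerDl.
have lU U e : F U -> 0 < e -> (forall f g, U f -> U g -> `|f - g| < e) ->
    forall f, U f -> forall x, `|l x - f x| <= e * `|x|.
  move=> FU e0 UP f Uf x; apply/ler_addgt0Pl => d d0.
  have [g [/= g1 Ug]] := filter_ex (filterI (lP x _ d0) FU).
  have -> : l x - f x = (l x - g x) + (g - f) x.
    by rewrite dualDE dualNE addrA subrK.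
  rewrite (le_trans (ler_normD _ _))// lerD ?(ltW g1)//.
  by rewrite (le_trans (dual_normP _ _))// ler_wpM2r// ltW// UP.
have lb : (l : V -> K^o) \in blin V K^o.
  apply/blinP; split => //; have [U FU UP] := Fc' 1 ltr01.
  have [f Uf] := filter_ex FU.
  exists (1 + dual_norm f) => x.
  rewrite -(subrK (f x) (l x)) (le_trans (ler_normD _ _))// mulrDl.
  by rewrite lerD ?dual_normP// (lU U).
apply/cvg_ex; exists (Dual lb); apply/fcvgrPdist_lt => e e0.
have e2 : 0 < e / 2%:R by rewrite divr_gt0.
have [U FU UP] := Fc' _ e2.
apply: filterS (FU) => f Uf; rewrite dual_normE (@le_lt_trans _ _ (e / 2%:R))//.
  apply: dual_norm_le => x x1; rewrite dualDE dualNE /=.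
  by rewrite (le_trans (lU _ _ FU e2 UP _ Uf x))// ler_piMr// ltW.
by rewrite ltr_pdivrMr// ltr_pMr// ltr1n.
Qed.

HB.instance Definition _ := Uniform_isComplete.Build (dual V) dual_cauchy_cvg.

End dual.
End dual_type.

(* Banach algebras are not assumed to be unital. *)
HB.mixin Record isBanachAlgebra (K : numFieldType) A
    of CompleteNormedModule K A := {
  bmul : A -> A -> A ;
  bmulA : forall a b c, bmul a (bmul b c) = bmul (bmul a b) c ;
  bmul_linearl : forall b, linear (bmul^~ b) ;
  bmul_linearr : forall a, linear (bmul a) ;
  ler_norm_bmul : forall a b, `|bmul a b| <= `|a| * `|b| }.

#[short(type="banachAlgType")]
HB.structure Definition BanachAlgebra (K : numFieldType) :=
  {A of CompleteNormedModule K A & isBanachAlgebra K A}.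

HB.mixin Record isBanachBimodule (K : numFieldType) (A : banachAlgType K) E
    of CompleteNormedModule K E := {
  lact : A -> E -> E ;
  ract : E -> A -> E ;
  lact_linearl : forall x, linear (lact^~ x) ;
  lact_linearr : forall a, linear (lact a) ;
  ract_linearl : forall a, linear (ract^~ a) ;
  ract_linearr : forall x, linear (ract x) ;
  lactA : forall a b x, lact a (lact b x) = lact (bmul a b) x ;
  ractA : forall x a b, ract (ract x a) b = ract x (bmul a b) ;
  lractA : forall a x b, ract (lact a x) b = lact a (ract x b) ;
  ler_norm_lact : exists M, forall a x, `|lact a x| <= M * (`|a| * `|x|) ;
  ler_norm_ract : exists M, forall x a, `|ract x a| <= M * (`|x| * `|a|) }.

#[short(type="banachBimodType")]
HB.structure Definition BanachBimodule (K : numFieldType)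
    (A : banachAlgType K) :=
  {E of CompleteNormedModule K E & isBanachBimodule K A E}.

Section dual_bimodule.
Context {R : realType} {s : scalar_kind}.
Local Notation K := (scalars R s).
Variables (A : banachAlgType K) (E : banachBimodType A).

Lemma dual_compP (f : dual E) (u : E -> E) :
  bounded_linear u -> (f \o u : E -> K^o) \in blin E K^o.
Proof.
move=> [ul [M uM]]; apply/blinP; split.
  by move=> a x y; rewrite /= ul dual_linear.
exists (`|f| * M) => x; rewrite /= (le_trans (dual_normP f _))//.
by rewrite -dual_normE -mulrA ler_wpM2l.
Qed.

Lemma lact_bounded_linear (a : A) : bounded_linear (lact a : E -> E).
Proof.
split; first exact: lact_linearr.
have [M lM] := @ler_norm_lact _ _ E.
by exists (M * `|a|) => x; rewrite -mulrA.
Qed.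

Lemma ract_bounded_linear (a : A) : bounded_linear ((@ract _ _ E)^~ a).
Proof.
split; first exact: ract_linearl.
have [M rM] := @ler_norm_ract _ _ E.
by exists (M * `|a|) => x; rewrite -mulrA [`|a| * _]mulrC.
Qed.

(* <a f, x> = <f, x a> and <f a, x> = <f, a x> *)
Definition dual_lact (a : A) (f : dual E) : dual E :=
  Dual (dual_compP f (ract_bounded_linear a)).

Definition dual_ract (f : dual E) (a : A) : dual E :=
  Dual (dual_compP f (lact_bounded_linear a)).

Lemma dual_lactE a f x : dual_lact a f x = f (ract x a). Proof. by []. Qed.
Lemma dual_ractE f a x : dual_ract f a x = f (lact a x). Proof. by []. Qed.

Lemma dual_lact_linearl f : linear (dual_lact^~ f).
Proof.
move=> c a b; apply: dual_eqP => x.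
by rewrite dualDE dualZE !dual_lactE ract_linearr dual_linear.
Qed.

Lemma dual_lact_linearr a : linear (dual_lact a).
Proof. by move=> c f g; apply: dual_eqP. Qed.

Lemma dual_ract_linearl a : linear (dual_ract^~ a).
Proof. by move=> c f g; apply: dual_eqP. Qed.

Lemma dual_ract_linearr f : linear (dual_ract f).
Proof.
move=> c a b; apply: dual_eqP => x.
by rewrite dualDE dualZE !dual_ractE lact_linearl dual_linear.
Qed.

Lemma dual_lactA a b f : dual_lact a (dual_lact b f) = dual_lact (bmul a b) f.
Proof. by apply: dual_eqP => x; rewrite !dual_lactE ractA. Qed.

Lemma dual_ractA f a b : dual_ract (dual_ract f a) b = dual_ract f (bmul a b).
Proof. by apply: dual_eqP => x; rewrite !dual_ractE lactA. Qed.

Lemma dual_lractA a f b :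
  dual_ract (dual_lact a f) b = dual_lact a (dual_ract f b).
Proof.
by apply: dual_eqP => x; rewrite !(dual_lactE, dual_ractE) lractA.
Qed.

Lemma ler_norm_dual_lact :
  exists M, forall a f, `|dual_lact a f| <= M * (`|a| * `|f|).
Proof.
have [M rM] := @ler_norm_ract _ _ E; exists `|M| => a f.
rewrite [leLHS]dual_normE; apply: dual_norm_le => x x1.
rewrite dual_lactE (le_trans (dual_normP f _))// -dual_normE.
rewrite mulrA [leRHS]mulrC ler_wpM2l// (le_trans (rM x a))//.
rewrite -[leLHS]ger0_norm ?(le_trans _ (rM x a))// !normrM !normr_id.
by rewrite ler_wpM2l// ler_piMl.
Qed.

Lemma ler_norm_dual_ract :
  exists M, forall f a, `|dual_ract f a| <= M * (`|f| * `|a|).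
Proof.
have [M lM] := @ler_norm_lact _ _ E; exists `|M| => f a.
rewrite [leLHS]dual_normE; apply: dual_norm_le => x x1.
rewrite dual_ractE (le_trans (dual_normP f _))// -dual_normE.
rewrite mulrCA ler_wpM2l// (le_trans (lM a x))//.
rewrite -[leLHS]ger0_norm ?(le_trans _ (lM a x))// !normrM !normr_id.
by rewrite ler_wpM2l// ler_piMr.
Qed.

HB.instance Definition _ := isBanachBimodule.Build K A (dual E)
  dual_lact_linearl dual_lact_linearr dual_ract_linearl dual_ract_linearr
  dual_lactA dual_ractA dual_lractA ler_norm_dual_lact ler_norm_dual_ract.

End dual_bimodule.

Fixpoint iter_dual (R : realType) (s : scalar_kind)
    (A : banachAlgType (scalars R s)) (B : banachBimodType A) (n : nat) :
    banachBimodType A :=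
  if n is m.+1 then dual (iter_dual B m) else B.

Section cohomology.
Context {K : numFieldType}.
Variables (A : banachAlgType K) (E : banachBimodType A).

Definition derivation (D : A -> E) : Prop :=
  bounded_linear D /\ forall a b, D (bmul a b) = lact a (D b) + ract (D a) b.

Definition inner (D : A -> E) : Prop :=
  exists e : E, forall a, D a = lact a e - ract e a.

Lemma linear_sub_scale (V W : lmodType K) (f : V -> W) :
  linear f -> [/\ f 0 = 0, forall x y, f (x + y) = f x + f y &
    forall a x, f (a *: x) = a *: f x].
Proof.
move=> lf; have f0 : f 0 = 0.
  by have := lf (-1) 0 0; rewrite scaler0 addr0 scaleN1r addNr.
split=> // [x y|a x]; first by have := lf 1 x y; rewrite !scale1r.
by have := lf a x 0; rewrite f0 !addr0.
Qed.

Definition derivations : {pred A -> E} := mem [set D | derivation D].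

Lemma derivationsP D : reflect (derivation D) (D \in derivations).
Proof. exact: asboolP. Qed.

Lemma derivations_submod_closed : GRing.submod_closed derivations.
Proof.
split.
  apply/derivationsP; split; first exact/blinP/rpred0.
  move=> a b; change (0 = lact a (0 : E) + ract (0 : E) b).
  have [-> _ _] := linear_sub_scale (lact_linearr (s := E) a).
  have [-> _ _] := linear_sub_scale (ract_linearl (s := E) b).
  by rewrite addr0.
move=> c D1 D2 /derivationsP[b1 d1] /derivationsP[b2 d2].
apply/derivationsP; split.
  by apply/blinP; rewrite rpredD// ?rpredZ//; apply/blinP.
move=> a b; rewrite !fctE d1 d2 lact_linearr ract_linearl.
by rewrite scalerDr addrACA.
Qed.

HB.instance Definition _ :=
  GRing.isSubmodClosed.Build K (A -> E) derivations derivations_submod_closed.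

Record Z1 := MkZ1 { Z1_val :> A -> E ; _ : Z1_val \in derivations }.

HB.instance Definition _ := [isSub for Z1_val].
HB.instance Definition _ := [Choice of Z1 by <:].
HB.instance Definition _ := [SubChoice_isSubLmodule of Z1 by <:].

Definition N1 : {pred Z1} := mem [set D : Z1 | inner D].

Lemma N1P (D : Z1) : reflect (inner D) (D \in N1).
Proof. exact: asboolP. Qed.

Lemma N1_submod_closed : GRing.submod_closed N1.
Proof.
split.
  apply/N1P; exists 0 => a.
  have [-> _ _] := linear_sub_scale (lact_linearr (s := E) a).
  have [-> _ _] := linear_sub_scale (ract_linearl (s := E) a).
  by rewrite subrr.
move=> c D1 D2 /N1P[e1 D1E] /N1P[e2 D2E].
apply/N1P; exists (c *: e1 + e2) => a.
rewrite lact_linearr ract_linearl -[LHS]/(c *: D1 a + D2 a) D1E D2E.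
by rewrite scalerBr opprD addrACA.
Qed.

HB.instance Definition _ :=
  GRing.isSubmodClosed.Build K Z1 N1 N1_submod_closed.

(* The quotient Z1 / N1, with its additive group structure. *)
Definition H1 := Quotient.quot N1.
HB.instance Definition _ := GRing.Zmodule.on H1.

End cohomology.

Arguments derivation {K A E} D.
Arguments inner {K A E} D.
Arguments derivations {K} A E.
Arguments Z1 {K} A E.
Arguments N1 {K} A E.
Arguments H1 {K} A E.

(* Main.v *)
(** The canonical embedding of [E'] into [E'''] is a bimodule map, and the
    transpose [P : E''' -> E'] of the canonical embedding of [E] into [E''] is a
    bimodule map splitting it. A derivation [D] into [E'] is therefore carried
    to a derivation into [E'''], and if the latter is implemented by [e] then
    [D] is implemented by [P e]. *)
Require Import Defs.
From HB Require Import structures.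
From mathcomp Require Import all_boot all_order all_algebra.
From mathcomp Require Import all_classical all_reals topology normedtype.

Import Order.TTheory GRing.Theory Num.Theory.
Local Open Scope ring_scope.

Lemma bounded_linear_comp {K : numFieldType} {U V W : normedModType K}
  (g : V -> W) (f : U -> V) :
  bounded_linear g -> bounded_linear f -> bounded_linear (g \o f).
Proof.
move=> gb [fl [M fM]]; have [gl _] := gb.
have [N N0 gN] := bounded_linear_ge0 gb.
split; first by move=> a x y; rewrite /= fl gl.
exists (N * M) => x; rewrite /= (le_trans (gN _))// -mulrA.
exact: ler_wpM2l.
Qed.

Section bidual.
Context {R : realType} {s : scalar_kind}.
Local Notation K := (scalars R s).
Variable V : normedModType K.

Lemma dual_eval_blin (x : V) : (fun f : dual V => f x : K^o) \in blin (dual V) K^o.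
Proof.
apply/blinP; split; first by [].
by exists `|x| => f; rewrite mulrC; exact: dual_normP.
Qed.

Definition bidual_embed (x : V) : dual (dual V) := Dual (dual_eval_blin x).

Lemma bidual_embedE x f : bidual_embed x f = f x. Proof. by []. Qed.

Lemma bidual_embed_bounded_linear : bounded_linear bidual_embed.
Proof.
split; first by move=> a x y; apply: dual_eqP => f; exact: dual_linear.
(* The bidual norm is a supremum over [f] in the unit ball, where |f x| <= |f| |x| <= |x|. *)
exists 1 => x; rewrite mul1r [leLHS]dual_normE; apply: dual_norm_le => f f1.
rewrite bidual_embedE (le_trans (dual_normP f x))//.
exact: ler_piMl.
Qed.

End bidual.

Section transpose.
Context {R : realType} {s : scalar_kind}.
Local Notation K := (scalars R s).
Variable V : normedModType K.

Lemma dual_comp_blin {W : normedModType K} (u : V -> W) (f : dual W) :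
  bounded_linear u -> (f \o u : V -> K^o) \in blin V K^o.
Proof. by move=> ub; apply/blinP/bounded_linear_comp => //; exact: dualP. Qed.

(** The map P above: restriction of functionals on V'' to the canonical image of V. *)
Definition tridual_proj (f : dual (dual (dual V))) : dual V :=
  Dual (dual_comp_blin _ f (bidual_embed_bounded_linear V)).

Lemma tridual_projE f x : tridual_proj f x = f (bidual_embed V x).
Proof. by []. Qed.

(** With J for both embeddings, P(Jf)(x) = (Jf)(Jx) = (Jx)(f) = f(x). *)
Lemma bidual_embedK : cancel (bidual_embed (dual V)) tridual_proj.
Proof. by move=> f; exact: dual_eqP. Qed.

Lemma tridual_projB f g :
  tridual_proj (f - g) = tridual_proj f - tridual_proj g.
Proof. exact: dual_eqP. Qed.

End transpose.

Section bimodule.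
Context {R : realType} {s : scalar_kind}.
Local Notation K := (scalars R s).
Variables (A : banachAlgType K) (E : banachBimodType A).

(** Dualizing swaps the sides, and doing it twice restores them: (a Jx)(f) = (Jx)(f a) = (f a)(x) =
    f(a x). *)
Lemma bidual_embed_lact (a : A) (x : E) :
  bidual_embed E (lact a x) = lact a (bidual_embed E x).
Proof. exact: dual_eqP. Qed.

Lemma bidual_embed_ract (x : E) (a : A) :
  bidual_embed E (ract x a) = ract (bidual_embed E x) a.
Proof. exact: dual_eqP. Qed.

(** The left action on a dual transposes the right action below it, hence the appeal to
    [bidual_embed_ract]. *)
Lemma tridual_proj_lact (a : A) (f : dual (dual (dual E))) :
  tridual_proj E (lact a f) = lact a (tridual_proj E f).
Proof.
apply: dual_eqP => x.
rewrite [RHS]dual_lactE !tridual_projE bidual_embed_ract; exact: dual_lactE.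
Qed.

Lemma tridual_proj_ract (f : dual (dual (dual E))) (a : A) :
  tridual_proj E (ract f a) = ract (tridual_proj E f) a.
Proof.
apply: dual_eqP => x.
rewrite [RHS]dual_ractE !tridual_projE bidual_embed_lact; exact: dual_ractE.
Qed.

Lemma derivation_bidual_embed (D : A -> E) :
  derivation D -> derivation (bidual_embed E \o D).
Proof.
move=> [Db Dd]; have Jb := bidual_embed_bounded_linear E.
split; first exact: bounded_linear_comp.
move=> a b; have [_ JD _] := linear_sub_scale Jb.1.
by rewrite /= Dd JD bidual_embed_lact bidual_embed_ract.
Qed.

(** a(Pe) - (Pe)a = P(ae - ea) = P(J(D a)) = D a. Since P takes values in a dual, [D] must too; this
    is where n >= 1 enters. *)
Lemma inner_bidual_embed (D : A -> dual E) :
  inner (bidual_embed (dual E) \o D) -> inner D.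
Proof.
move=> [e De]; exists (tridual_proj E e) => a.
rewrite -tridual_proj_lact -tridual_proj_ract -tridual_projB -De.
by rewrite /= bidual_embedK.
Qed.

End bimodule.

Lemma H1_eq0P {K : numFieldType} {A : banachAlgType K} {E : banachBimodType A} :
  (forall h : H1 A E, h = 0) <-> (forall D : A -> E, derivation D -> inner D).
Proof.
have pi_eq0 (D : Z1 A E) : (\pi_(H1 A E) D = 0)%qT <-> inner D.
  (* Writing 0 as the class of the zero derivation turns equality of classes into D - 0 in [N1]. *)
  have -> : (0 : H1 A E) = (\pi_(H1 A E) 0)%qT by rewrite piE.
  split=> [/eqP|/N1P]; first by rewrite -Quotient.idealrBE subr0 => /N1P.
  by move=> D0; apply/eqP; rewrite -Quotient.idealrBE subr0.
split=> [H D /derivationsP Dd|H h].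
  exact/(pi_eq0 (MkZ1 Dd))/H.
rewrite -[h]reprK; apply/pi_eq0/H; exact/derivationsP/valP.
Qed.

Theorem mainTheorem5 (R : realType) (s : scalar_kind)
    (A : banachAlgType (scalars R s)) (B : banachBimodType A)
    (n : nat) (hn : (1 <= n)%N) :
  (forall h : H1 A (iter_dual B n.+2), h = 0) ->
  forall h : H1 A (iter_dual B n), h = 0.
Proof.
(* Now [n] is the predecessor, and the two modules unfold to the dual and the triple dual of
   [iter_dual B n]. *)
case: n hn => // n _ /H1_eq0P H; apply/H1_eq0P => D Dd.
exact/inner_bidual_embed/H/derivation_bidual_embed.
Qed.
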